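(* Let $\mu$ be a self-similar measure on $\mathbb{R}$ that satisfies the asymptotic gap weak separation condition and has $\operatorname{supp}\mu=[0,1]$. Then $\dim_{qA}\mu<\infty$ if and only if $\mu$ is quasi-doubling.
   Context: $B(x,r)$ denotes the ball of centre $x$ and radius $r$. Self-similar measures. An iterated function system (IFS) is a finite family $\{S_j\}_{j=0}^{m-1}$ of maps $S_j(x)=r_jx+d_j$ on $\mathbb{R}$ with $0<r_j<1$, $d_j\in\mathbb{R}$. Its attractor is the unique non-empty compact set $F$ with $F=\bigcup_j S_j(F)$; here $F=[0,1]$, and the maps are labelled so that $S_0(0)=0$ and $S_{m-1}(1)=1$. Given probabilities $p_j>0$, $\sum_j p_j=1$, the associated self-similar measure $\mu$ is the unique Borel probability measure with $\mu(E)=\sum_j p_j\mu(S_j^{-1}(E))$ for all Borel sets $E$; its support is $[0,1]$. Put $\lambda=\min_j r_j$. For a finite word $w=w_1\cdots w_n$ put $S_w=S_{w_1}\circ\cdots\circ S_{w_n}$, $r_w=r_{w_1}\cdots r_{w_n}$, $w^-=w_1\cdots w_{n-1}$. For $n\ge 1$, $\Lambda_n$ is the set of finite words $u$ with $r_u\leq\lambda^n$ and $r_{u^-}>\lambda^n$. Asymptotic gap weak separation condition (AGWSC). There is a non-increasing function $f(n)>0$ with $(\log f(n))/n\to0$ as $n\to\infty$ such that for all $n$, all $u,w\in\Lambda_n$ and each $z\in\{0,1\}$: if $S_u(z)\neq S_w(z)$ then $|S_u(z)-S_w(z)|\geq f(n)\lambda^n$. A self-similar measure satisfies the AGWSC if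 its underlying IFS does. Quasi-doubling. A compactly supported Borel probability measure $\mu$ is quasi-doubling if for every $\varepsilon>0$ and every positive, non-decreasing function $G(r)$ satisfying $\log G(r)/\log r\to0$ as $r\to0$, there exists $c>0$ such that $\mu(B(x,G(r)r))\geq c\,r^\varepsilon\mu(B(x,2r))$ for all $x\in\operatorname{supp}\mu$ and $r\in(0,1)$. Quasi-Assouad dimension. For $\delta\ge0$ let $H(\delta)$ be the infimum of all $s$ for which there exist $C_1,C_2>0$ such that for all $0<r\leq R^{1+\delta}\leq R\leq C_1$, $\sup_{x\in\operatorname{supp}\mu}\frac{\mu(B(x,R))}{\mu(B(x,r))}\leq C_2(R/r)^s$. Then $\dim_{qA}\mu=\lim_{\delta\to0}H(\delta)$. *)

(* Defs.v *)
From HB Require Import structures.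
From mathcomp Require Import all_boot all_order all_algebra.
From mathcomp Require Import all_classical all_reals all_analysis.

Set Implicit Arguments.
Unset Strict Implicit.
Unset Printing Implicit Defensive.

Import Order.TTheory GRing.Theory Num.Theory.
Import numFieldNormedType.Exports.

Local Open Scope classical_set_scope.
Local Open Scope ring_scope.

(* A finite family of m.+1 maps, so that S_0 is indexed by ord0 and the last
   map by ord_max. *)
Record ifs (R : realType) (m : nat) := IFS {
  ratio : 'I_m.+1 -> R;
  shift : 'I_m.+1 -> R;
  ratio_gt0 : forall j, 0 < ratio j;
  ratio_lt1 : forall j, ratio j < 1 }.

Definition ifs_map (R : realType) (m : nat) (S : ifs R m) (j : 'I_m.+1) (x : R)
  : R := ratio S j * x + shift S j.

(* This determines F uniquely, by Hutchinson's theorem. *)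
Definition is_attractor (R : realType) (m : nat) (S : ifs R m) (F : set R)
  : Prop :=
  [/\ F !=set0, compact F & F = \bigcup_j (ifs_map S j @` F)].

(* All ratios are < 1, so the default value 1 never contributes. *)
Definition min_ratio (R : realType) (m : nat) (S : ifs R m) : R :=
  \big[Num.min/1]_(j < m.+1) ratio S j.

Definition word (m : nat) := seq 'I_m.+1.

Definition word_map (R : realType) (m : nat) (S : ifs R m) (w : word m)
  : R -> R := foldr (fun j g => ifs_map S j \o g) id w.

Definition word_ratio (R : realType) (m : nat) (S : ifs R m) (w : word m) : R :=
  \prod_(j <- w) ratio S j.

Definition word_parent (m : nat) (w : word m) : word m := take (size w).-1 w.

(* Only meant for n >= 1, where the empty word is excluded because its ratio
   is 1 > min_ratio S ^+ n. *)
Definition Lambda (R : realType) (m : nat) (S : ifs R m) (n : nat)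
  : set (word m) :=
  [set u | word_ratio S u <= min_ratio S ^+ n /\
           min_ratio S ^+ n < word_ratio S (word_parent u)].

Definition AGWSC (R : realType) (m : nat) (S : ifs R m) : Prop :=
  exists f : nat -> R,
    [/\ forall n, 0 < f n,
        {homo f : n k / (n <= k)%N >-> k <= n},
        (ln (f n) / n%:R) @[n --> \oo] --> (0 : R) &
        forall n u w (z : R), (1 <= n)%N -> Lambda S n u -> Lambda S n w ->
          z = 0 \/ z = 1 -> word_map S u z <> word_map S w z ->
          f n * min_ratio S ^+ n <= `|word_map S u z - word_map S w z| ].

(* This determines mu uniquely among Borel probability measures. *)
Definition self_similar (R : realType) (m : nat) (S : ifs R m)
    (p : 'I_m.+1 -> R) (mu : probability (measurableTypeR R) R) : Prop :=
  [/\ forall j, 0 < p j,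
      \sum_(j < m.+1) p j = 1 &
      forall E : set R, measurable (E : set (measurableTypeR R)) ->
        mu E = (\sum_(j < m.+1) (p j)%:E * mu (ifs_map S j @^-1` E))%E].

Definition supp (R : realType) (mu : probability (measurableTypeR R) R)
  : set R :=
  [set x | forall U : set R, open U -> U x -> (0 < mu U)%E].

Definition quasi_doubling (R : realType)
    (mu : probability (measurableTypeR R) R) : Prop :=
  forall (eps : R) (G : R -> R), 0 < eps ->
    (forall r : R, 0 < r < 1 -> 0 < G r) ->
    (forall r s : R, 0 < r -> r <= s -> s < 1 -> G r <= G s) ->
    (ln (G r) / ln r) @[r --> 0^'+] --> (0 : R) ->
    exists2 c : R, 0 < c &
      forall x r : R, supp mu x -> 0 < r < 1 ->
        ((c * r `^ eps)%:E * mu (ball x (2 * r)) <= mu (ball x (G r * r)))%E.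

Definition qA_exponent (R : realType)
    (mu : probability (measurableTypeR R) R) (delta s : R) : Prop :=
  exists C1 C2 : R, [/\ 0 < C1, 0 < C2 &
    forall r rho : R, 0 < r -> r <= rho `^ (1 + delta) ->
      rho `^ (1 + delta) <= rho -> rho <= C1 ->
      (ereal_sup [set mu (ball x rho) / mu (ball x r) | x in supp mu]
        <= (C2 * (rho / r) `^ s)%:E)%E].

(* Valued in \bar R: the infimum over no exponent is +oo. *)
Definition qA_H (R : realType) (mu : probability (measurableTypeR R) R)
    (delta : R) : \bar R :=
  ereal_inf (EFin @` [set s | qA_exponent mu delta s]).

(* qA_H mu is non-increasing on the positive reals, so this limit exists. *)
Definition dim_qA (R : realType) (mu : probability (measurableTypeR R) R)
  : \bar R := lim (qA_H mu delta @[delta --> 0^'+]).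

(* Main.v *)
(* If dim_qA mu <= s, compare B(x, 2r) with B(x, r^(1+delta)) for delta s <= eps;
   a subpolynomial G satisfies G(r) r >= r^(1+delta) for small r.

   Conversely, let lam^n be comparable to R. Quasi-doubling with G given by the gap
   function f bounds mu(B(x, R)) by R^(-eps) mu(B(x, rho)), where rho = f(n) lam^n.
   By the gap condition at most one left endpoint a > x and one right endpoint b < x
   of words of generation n lie within rho of x. If the words starting at a carry
   weight P, then mu(B(x, 2(a - x))) >= P ((a - x)/R)^N, and quasi-doubling with G = 1
   transfers this to B(x, a - x), which misses these words; similarly for b. Hence,
   up to powers of r/R and r^eps, the words whose interval contains x carry weight at
   least mu(B(x, R)), and each of them gives B(x, r) a proportion at least (r/R)^N.
   For r <= R^(1+delta) and eps small compared to delta, the factors r^eps are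
   absorbed in a power of r/R. Overlaps need not be counted, since weights of words
   are summed rather than maximised. *)
Require Import Defs.
From HB Require Import structures.
From mathcomp Require Import all_boot all_order all_algebra.
From mathcomp Require Import all_classical all_reals all_analysis.
Import Order.TTheory GRing.Theory Num.Theory.
Import numFieldNormedType.Exports.
Local Open Scope classical_set_scope.
Local Open Scope ring_scope.
From mathcomp Require Import measurable_realfun ring lra.
Set Implicit Arguments.
Unset Strict Implicit.
Unset Printing Implicit Defensive.

(** * Real-valued masses of sets and continuity along monotone sequences *)

Section Mass.
Variables (R : realType) (mu : probability (measurableTypeR R) R).

Definition mass (E : set R) : R := fine (mu E).

Lemma massE (E : set R) : measurable (E : set (measurableTypeR R)) ->
  mu E = (mass E)%:E.
Proof. by move=> mE; rewrite fineK // fin_num_measure. Qed.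

Lemma mass_ge0 (E : set R) : 0 <= mass E.
Proof. exact/fine_ge0/measure_ge0. Qed.

Lemma le_mass (A B : set R) : measurable (A : set (measurableTypeR R)) ->
  measurable (B : set (measurableTypeR R)) -> A `<=` B -> mass A <= mass B.
Proof.
move=> mA mB AB; rewrite -lee_fin -!massE //.
by apply: le_measure; rewrite ?inE.
Qed.

Lemma mass_le1 (A : set R) : measurable (A : set (measurableTypeR R)) ->
  mass A <= 1.
Proof. by move=> mA; rewrite -lee_fin -massE // probability_le1. Qed.

Lemma le_mass_ball (x r s : R) : r <= s -> mass (ball x r) <= mass (ball x s).
Proof.
move=> rs; apply: le_mass; [exact: measurable_ball|exact: measurable_realfun.measurable_ball|].
exact: le_ball.
Qed.

Lemma mass_disjoint (A B : set R) : measurable (A : set (measurableTypeR R)) ->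
  measurable (B : set (measurableTypeR R)) -> mass A = 1 ->
  A `&` B = set0 -> mass B = 0.
Proof.
move=> mA mB A1 AB0.
have mAB : measurable (A `|` B : set (measurableTypeR R)) by exact: measurableU.
have : mass (A `|` B) = mass A + mass B.
  by apply/EFin_inj; rewrite EFinD -!massE // measureU.
by have := mass_le1 mAB; have := mass_ge0 B; lra.
Qed.

Lemma mass_bigcup_le (A : nat -> set R) (c : R) :
  (forall n, measurable (A n : set (measurableTypeR R))) ->
  (forall n k, (n <= k)%N -> A n `<=` A k) -> \bigcup_n A n = setT ->
  (forall n, mass (A n) <= c) -> 1 <= c.
Proof.
move=> mA ndA AT Ac.
have mT : measurable (\bigcup_n A n : set (measurableTypeR R)).
  exact: bigcupT_measurable.
have mu1 : mu (\bigcup_n A n) = 1%E by rewrite AT; exact: probability_setT.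
have cv : (mu \o A) n @[n --> \oo] --> 1%E.
  by rewrite -mu1; apply: nondecreasing_cvg_mu => // n k nk; apply/subsetPset/ndA.
rewrite -lee_fin; apply: (cvge_le _ cv).
by apply: nearW => n; rewrite /= massE // lee_fin.
Qed.

Lemma mass_bigcap1 (A : nat -> set R) :
  (forall n, measurable (A n : set (measurableTypeR R))) ->
  (forall n k, (n <= k)%N -> A k `<=` A n) ->
  (forall n, mass (A n) = 1) -> mass (\bigcap_n A n) = 1.
Proof.
move=> mA niA A1.
have mI : measurable (\bigcap_n A n : set (measurableTypeR R)).
  exact: bigcapT_measurable.
have cv : (mu \o A) n @[n --> \oo] --> mu (\bigcap_n A n).
  apply: nonincreasing_cvg_mu => //.
    by have := massE (mA 0%N) => /= ->; rewrite ltry.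
  by move=> n k nk; apply/subsetPset/niA.
have cv1 : (mu \o A) n @[n --> \oo] --> 1%E.
  by apply: cvg_near_cst; apply: nearW => n /=; rewrite massE // A1.
by apply/EFin_inj; rewrite -massE //; apply: (cvg_unique _ cv cv1).
Qed.

End Mass.

(** * Elementary facts on powers, sums and families of reals with gaps *)

Lemma expr_lt_ex (R : realType) (q e : R) : 0 < q < 1 -> 0 < e ->
  exists k, q ^+ k < e.
Proof.
move=> /andP[q0 q1] e0.
have /cvgrPdist_lt /(_ _ e0) : q ^+ k @[k --> \oo] --> (0 : R).
  by apply: cvg_expr; rewrite gtr0_norm.
move=> [k _ /(_ k (leqnn _))] /=.
by rewrite sub0r normrN ger0_norm ?exprn_ge0 ?ltW // => ?; exists k.
Qed.

Lemma sum_orb_le (R : realDomainType) (T : Type) (W : seq T) (P Q : pred T) (F : T -> R) :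
  (forall u, 0 <= F u) ->
  \sum_(u <- W | P u || Q u) F u <= \sum_(u <- W | P u) F u + \sum_(u <- W | Q u) F u.
Proof.
move=> F0; rewrite big_mkcond [X in _ <= X + _]big_mkcond [X in _ <= _ + X]big_mkcond.
rewrite -big_split /=.
by apply: ler_sum => u _; case: (P u); case: (Q u); rewrite ?addr0 ?add0r ?lerDl.
Qed.

(* [c], [a], [b] are the weights of the words that contain [x] and of those that
   lie on its nearer and farther side. *)
Lemma le_cascade (R : realDomainType) (k q M a b c : R) :
  0 <= k <= 1 -> 0 <= q <= 1 -> 0 <= M -> k * c <= M ->
  k * a <= M \/ q * k * a <= c -> k * b <= M \/ q * k * b <= c + a ->
  k ^+ 3 * q ^+ 2 * (c + a + b) <= 4 * M.
Proof.
move=> /andP[k0 k1] /andP[q0 q1] M0 kc ka kb.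
have scale (d y : R) : 0 <= d <= 1 -> y <= M -> d * y <= M.
  move=> /andP[d0 d1] yM; apply: (@le_trans _ _ (d * M)); first exact: ler_wpM2l.
  by rewrite ler_piMl.
have kq1 : 0 <= k * q <= 1 by rewrite mulr_ge0 //= mulr_ile1.
have kkq1 : 0 <= k ^+ 2 * q <= 1.
  by rewrite mulr_ge0 ?exprn_ge0 //= mulr_ile1 ?exprn_ge0 // exprn_ile1.
have kqq1 : 0 <= k ^+ 2 * q ^+ 2 <= 1.
  by rewrite mulr_ge0 ?exprn_ge0 //= mulr_ile1 ?exprn_ge0 // exprn_ile1.
(* In the second case [a] is charged to [c] at the price [q * k], and [c] to [M] at the price
   [k]. *)
have kkqa : k ^+ 2 * q * a <= M.
  case: ka => [/(scale _ _ kq1)|qka]; first by rewrite (_ : k * q * (k * a) = k ^+ 2 * q * a) //; ring.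
  have : k * (q * k * a) <= k * c by exact: ler_wpM2l.
  by rewrite (_ : k * (q * k * a) = k ^+ 2 * q * a); [lra|ring].
have /(scale _ _ kqq1) := kc.
have /(scale _ _ kq1) := kkqa.
(* Here [b] may be charged to [c + a], and each of these to [M], hence the 2. One [M] for [c] and
   one for [a] complete the final constant 4. *)
have kkkqqb : k ^+ 3 * q ^+ 2 * b <= 2 * M.
  case: kb => [/(scale _ _ kqq1)|qkb].
    by rewrite (_ : k ^+ 2 * q ^+ 2 * (k * b) = k ^+ 3 * q ^+ 2 * b); [lra|ring].
  have : k ^+ 2 * q * (q * k * b) <= k ^+ 2 * q * (c + a).
    by apply: ler_wpM2l => //; case/andP: kkq1.
  have /(scale _ _ kq1) := kc.
  rewrite (_ : k ^+ 2 * q * (q * k * b) = k ^+ 3 * q ^+ 2 * b); last ring.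
  rewrite (_ : k ^+ 2 * q * (c + a) = k * q * (k * c) + k ^+ 2 * q * a); last ring.
  by lra.
rewrite (_ : k * q * (k ^+ 2 * q * a) = k ^+ 3 * q ^+ 2 * a); last ring.
rewrite (_ : k ^+ 2 * q ^+ 2 * (k * c) = k ^+ 3 * q ^+ 2 * c); last ring.
by rewrite !mulrDr; lra.
Qed.

(** Two values strictly between 0 and [d] differ by less than [d], so the gap forces them to agree.
    If there is no such value, [t = d] is a default, which is why [t <= d] is not strict. *)
Lemma unique_value_ex (R : realDomainType) (T : eqType) (W : seq T) (e : T -> R) (d : R) :
  0 < d -> (forall u w, u \in W -> w \in W -> e u <> e w -> d <= `|e u - e w|) ->
  exists2 t, 0 < t <= d & forall u, u \in W -> 0 < e u < d -> e u = t.
Proof.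
move=> d0 gap; have [/hasP[u uW ud]|/hasPn none] := boolP (has (fun u => 0 < e u < d) W).
  exists (e u); first by case/andP: ud => -> /ltW ->.
  move=> w wW wd; apply/eqP/negPn/negP => /eqP /(gap _ _ wW uW).
  rewrite leNgt ltr_norml; move: ud wd => /andP[? ?] /andP[? ?].
  by move=> /negP; apply; apply/andP; split; lra.
by exists d => [|u /none /negP//]; rewrite d0 lexx.
Qed.

(** * Word maps, their ratios and their action on balls *)

Section Iteration.
Variables (R : realType) (m : nat) (S : ifs R m).

Local Notation lam := (min_ratio S).

Lemma min_ratio_le j : lam <= Defs.ratio S j.
Proof. exact: bigmin_le. Qed.

Lemma min_ratio_gt0 : 0 < lam.
Proof. by apply: lt_bigmin => // j _; exact: ratio_gt0. Qed.

Lemma min_ratio_lt1 : lam < 1.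
Proof. exact: le_lt_trans (min_ratio_le ord0) (ratio_lt1 S ord0). Qed.

Lemma max_ratio_ex : exists2 q : R, 0 < q < 1 & forall j, Defs.ratio S j <= q.
Proof.
exists (\big[Num.max/lam]_(j < m.+1) Defs.ratio S j).
  rewrite (lt_le_trans min_ratio_gt0) ?bigmax_ge_id //=.
  by apply: bigmax_lt => [|j _]; [exact: min_ratio_lt1|exact: ratio_lt1].
by move=> j; exact: le_bigmax.
Qed.

Lemma word_ratio_gt0 w : 0 < word_ratio S w.
Proof. by apply: prodr_gt0 => j _; exact: ratio_gt0. Qed.

Lemma word_ratio_rcons w j : word_ratio S (rcons w j) = word_ratio S w * Defs.ratio S j.
Proof. by rewrite /word_ratio -cats1 big_cat /= big_seq1. Qed.

Lemma word_map_rcons w j x :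
  word_map S (rcons w j) x = word_map S w (ifs_map S j x).
Proof. by elim: w => [//|i w IH] /=; rewrite IH. Qed.

Lemma word_mapE w x : word_map S w x = word_ratio S w * x + word_map S w 0.
Proof.
elim: w => [|j w IH] /=; first by rewrite /word_ratio big_nil mul1r addr0.
by rewrite IH /ifs_map /word_ratio big_cons; ring.
Qed.

Lemma measurable_word_preimage w (E : set R) :
  measurable (E : set (measurableTypeR R)) ->
  measurable (word_map S w @^-1` E : set (measurableTypeR R)).
Proof.
move=> mE; rewrite -[X in measurable X]setTI.
have -> : word_map S w = (fun x : R => word_ratio S w * x + word_map S w 0).
  by apply/funext => x; rewrite word_mapE.
suff mf : measurable_fun (setT : set (measurableTypeR R))
    (fun x : measurableTypeR R => (word_ratio S w * x + word_map S w 0 : measurableTypeR R)).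
  exact: mf.
by apply: measurable_funD => //; apply: measurable_funM.
Qed.

Lemma ifs_mapE j : ifs_map S j = word_map S [:: j].
Proof. by []. Qed.

Lemma word_preimage_ball w (x r : R) :
  word_map S w @^-1` ball (word_map S w x) r = ball x (r / word_ratio S w).
Proof.
have dist y : `|word_map S w x - word_map S w y| = `|x - y| * word_ratio S w.
  rewrite (word_mapE _ x) (word_mapE _ y) -[in RHS](gtr0_norm (word_ratio_gt0 w)).
  by rewrite -normrM; congr `|_|; ring.
by apply/seteqP; split=> y; rewrite /ball /= dist ltr_pdivlMr ?word_ratio_gt0.
Qed.

End Iteration.

(** * Self-similar measures on the unit interval: total mass and lower bounds for balls *)

Section SelfSimilarMeasure.
Variables (R : realType) (m : nat) (S : ifs R m) (p : 'I_m.+1 -> R).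
Variable mu : probability (measurableTypeR R) R.
Hypothesis hF : is_attractor S `[0, 1]%classic.
Hypothesis hmu : self_similar S p mu.

Local Notation lam := (min_ratio S).

Lemma weight_gt0 j : 0 < p j.
Proof. by case: hmu. Qed.

Lemma sum_weight : \sum_j p j = 1.
Proof. by case: hmu. Qed.

Lemma mass_self_similar (E : set R) : measurable (E : set (measurableTypeR R)) ->
  mass mu E = \sum_j p j * mass mu (ifs_map S j @^-1` E).
Proof.
move=> mE; apply/EFin_inj; rewrite -massE //; case: hmu => _ _ /(_ E mE) ->.
rewrite -sumEFin; apply: eq_bigr => j _; rewrite EFinM -massE //.
by rewrite ifs_mapE; exact: measurable_word_preimage.
Qed.

Lemma ifs_map_unit j (y : R) : 0 <= y <= 1 -> 0 <= ifs_map S j y <= 1.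
Proof.
move=> y01; case: hF => _ _ /seteqP[_ /(_ (ifs_map S j y))].
rewrite /= in_itv /=; apply.
by exists j => //; exists y => //=; rewrite in_itv.
Qed.

Lemma ifs_map_unit_surj (y : R) : 0 <= y <= 1 ->
  exists j z, 0 <= z <= 1 /\ ifs_map S j z = y.
Proof.
move=> y01; case: hF => _ _ /seteqP[/(_ y) + _].
rewrite /= in_itv /= => /(_ y01) [j _ [z /=]]; rewrite in_itv /= => z01 zy.
by exists j, z.
Qed.

(** Every map preserves [[0, 1]] and contracts by at most [q], so it sends [[-e, 1 + e]] into
    [[-q e, 1 + q e]]. By self-similarity the mass does not drop when [e] is replaced by [q e];
    starting from the intervals that exhaust the line, all of the mass ends up near [[0, 1]]. *)
Lemma mass_unit_nbhs (d : R) : 0 < d -> mass mu `[- d, 1 + d]%classic = 1.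
Proof.
move=> d0; have mD (e : R) : measurable (`[- e, 1 + e]%classic : set (measurableTypeR R)).
  exact: measurable_itv.
have [q /andP[q0 q1] ratio_q] := max_ratio_ex S.
have contract (e : R) : 0 <= e ->
    mass mu `[- e, 1 + e]%classic <= mass mu `[- (q * e), 1 + q * e]%classic.
  move=> e0; rewrite (mass_self_similar (mD (q * e))).
  rewrite -[leLHS]mul1r -[X in X * _]sum_weight mulr_suml; apply: ler_sum => j _.
  rewrite ler_pM2l ?weight_gt0 //; apply: le_mass => //.
    by rewrite ifs_mapE; exact: measurable_word_preimage.
  move=> x /=; rewrite !in_itv /= => /andP[x0 x1].
  have /andP[S0 _] := @ifs_map_unit j 0 ltac:(lra).
  have /andP[_ S1] := @ifs_map_unit j 1 ltac:(lra).
  move: S0 S1; rewrite /ifs_map.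
  have := ratio_gt0 S j; have := ratio_q j; set r := Defs.ratio S j => rq r0 S0 S1.
  have re : 0 <= (q - r) * e by rewrite mulr_ge0 // subr_ge0.
  have rx0 : 0 <= r * (x + e) by apply: mulr_ge0; lra.
  have rx1 : 0 <= r * (1 + e - x) by apply: mulr_ge0; lra.
  by apply/andP; split; lra.
have iter (n k : nat) :
    mass mu `[- n%:R, 1 + n%:R]%classic <=
    mass mu `[- (q ^+ k * n%:R), 1 + q ^+ k * n%:R]%classic.
  elim: k => [|k IH]; first by rewrite mul1r.
  by apply: (le_trans IH); rewrite exprS -mulrA; apply: contract;
    rewrite mulr_ge0 // exprn_ge0 // ltW.
apply/eqP; rewrite eq_le mass_le1 //=.
apply: (@mass_bigcup_le _ mu (fun n => `[- n%:R, 1 + n%:R]%classic)).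
- by move=> n; exact: mD.
- move=> n k nk x /=; rewrite !in_itv /=.
  have : n%:R <= k%:R :> R by rewrite ler_nat.
  by move=> nk' /andP[? ?]; apply/andP; split; lra.
- apply/seteqP; split=> // x _; exists (Num.trunc `|x|).+1 => //=.
  rewrite in_itv /=; have := truncnS_gt `|x|; rewrite ltr_norml => /andP[].
  by lra.
move=> n; have [k qk] : exists k, q ^+ k * n%:R <= d.
  have dn : 0 < d / n.+1%:R by rewrite divr_gt0.
  have [|k] := @expr_lt_ex R q _ _ dn; first exact/andP.
  rewrite ltr_pdivlMr // => qk; exists k; apply: le_trans (ltW qk).
  by rewrite ler_wpM2l ?exprn_ge0 ?ler_nat // ltW.
apply: (le_trans (iter n k)); apply: le_mass => // x /=.
by rewrite !in_itv /= => /andP[? ?]; apply/andP; split; lra.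
Qed.

Lemma mass_unit : mass mu `[0, 1]%classic = 1.
Proof.
have -> : `[0 : R, 1]%classic = \bigcap_n `[- n.+1%:R^-1, 1 + n.+1%:R^-1]%classic.
  apply/seteqP; split=> x /=.
    rewrite in_itv /= => x01 n _ /=; rewrite in_itv /=.
    have : 0 < n.+1%:R^-1 :> R by rewrite invr_gt0.
    by move: n.+1%:R^-1 x01 => e /andP[? ?] ?; apply/andP; split; lra.
  move=> Dx; have D n : - n.+1%:R^-1 <= x <= 1 + n.+1%:R^-1.
    by have := Dx n I; rewrite /= in_itv.
  have small (e : R) : 0 < e -> exists n : nat, n.+1%:R^-1 < e.
    by move=> e0; have [n _ /(_ n (leqnn _))] := near_infty_natSinv_lt (PosNum e0); exists n.
  rewrite in_itv /=; apply/andP; split; rewrite leNgt; apply/negP => x0.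
    by have [n] := @small (- x) ltac:(lra); have /andP[] := D n; move: _^-1 => e; lra.
  by have [n] := @small (x - 1) ltac:(lra); have /andP[] := D n; move: _^-1 => e; lra.
apply: mass_bigcap1.
- by move=> n; exact: measurable_itv.
- move=> n k nk x /=; rewrite !in_itv /=.
  have : k.+1%:R^-1 <= n.+1%:R^-1 :> R by rewrite lef_pV2 ?posrE // ler_nat.
  by move: _^-1 _^-1 => e d ? /andP[? ?]; apply/andP; split; lra.
- by move=> n; apply: mass_unit_nbhs; rewrite invr_gt0.
Qed.

Lemma mass_off_unit (E : set R) : measurable (E : set (measurableTypeR R)) ->
  (forall y, E y -> ~ (0 <= y <= 1)) -> mass mu E = 0.
Proof.
move=> mE E01; apply: (mass_disjoint _ mE mass_unit); first exact: measurable_itv.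
by apply/seteqP; split=> // y [] /=; rewrite in_itv /= => y01 /E01.
Qed.

(** Such an [N] turns products of weights into powers of contraction ratios, and so gives polynomial
    lower bounds for masses of balls. *)
Lemma weight_exponent_ex : exists N : nat, forall j, Defs.ratio S j ^+ N <= p j.
Proof.
have [q q01 ratio_q] := max_ratio_ex S.
have [N_ HN_] := fin_all_exists (fun j => expr_lt_ex q01 (weight_gt0 j)).
exists (\max_j N_ j)%N => j; apply: le_trans (ltW (HN_ j)).
have q0 : 0 <= q by case/andP: q01 => /ltW.
apply: (@le_trans _ _ (q ^+ (\max_j N_ j))).
  by rewrite lerXn2r ?nnegrE // ltW // ratio_gt0.
have q1 : q <= 1 by case/andP: q01 => _ /ltW.
exact/(ler_wiXn2l q0 q1)/leq_bigmax.
Qed.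

(** Pull the ball back along a map whose image of [[0, 1]] contains the centre: the radius is
    divided by [ratio S j], and the mass lost is a factor [p j], at least the [N]-th power of that
    ratio. Once the radius exceeds 1 the ball contains [[0, 1]]. The factor [lam] allows for the
    last pull-back, which may overshoot 1 by up to [lam^-1]. *)
Lemma mass_ball_ge N (y rho : R) : (forall j, Defs.ratio S j ^+ N <= p j) ->
  0 <= y <= 1 -> 0 < rho -> lam * rho <= 1 ->
  (lam * rho) ^+ N <= mass mu (ball y rho).
Proof.
move=> ratioN y01 rho0; have [q /andP[q0 q1] ratio_q] := max_ratio_ex S.
have lam0 := min_ratio_gt0 S.
have [k qk] : exists k, q ^+ k < rho by apply: expr_lt_ex => //; exact/andP.
have large (x r : R) : 0 <= x <= 1 -> 1 < r -> lam * r <= 1 ->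
    (lam * r) ^+ N <= mass mu (ball x r).
  move=> /andP[x0 x1] r1 lr1; apply: (@le_trans _ _ 1).
    by rewrite exprn_ile1 // mulr_ge0 // ltW //; lra.
  rewrite -mass_unit; apply: le_mass.
  - exact: measurable_itv.
  - exact: measurable_ball.
  - move=> z /=; rewrite in_itv /ball /= => /andP[z0 z1].
    by rewrite ltr_norml; apply/andP; split; lra.
elim: k y rho y01 rho0 qk => [|k IH] y rho y01 rho0 qk rho1.
  by apply: large => //; move: qk; rewrite expr0.
have [rho_gt1|rho_le1] := ltP 1 rho; first exact: large.
have [j [z [z01 <-]]] := ifs_map_unit_surj y01.
have mB : measurable (ball (ifs_map S j z) rho : set (measurableTypeR R)).
  exact: measurable_ball.
have r0 : 0 < Defs.ratio S j by exact: ratio_gt0.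
have wr : word_ratio S [:: j] = Defs.ratio S j by rewrite /word_ratio big_seq1.
have pre : ifs_map S j @^-1` ball (ifs_map S j z) rho = ball z (rho / Defs.ratio S j).
  by rewrite ifs_mapE word_preimage_ball wr.
rewrite (mass_self_similar mB) (bigD1 j) //= pre.
apply: ler_wpDr.
  by apply: sumr_ge0 => i _; rewrite mulr_ge0 ?mass_ge0 // ltW // weight_gt0.
have IHj := IH z (rho / Defs.ratio S j) z01.
have qk' : q ^+ k < rho / Defs.ratio S j.
  rewrite ltr_pdivlMr //; apply: le_lt_trans qk.
  by rewrite exprSr ler_wpM2l ?ratio_q // exprn_ge0 // ltW.
have lr1 : lam * (rho / Defs.ratio S j) <= 1.
  rewrite mulrA ler_pdivrMr // mul1r -[leRHS]mulr1.
  by apply: ler_pM; rewrite ?min_ratio_le // ltW.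
apply: le_trans (ler_wpM2l (ltW (weight_gt0 j)) (IHj _ qk' lr1)); last first.
  by rewrite divr_gt0.
have -> : lam * rho = Defs.ratio S j * (lam * (rho / Defs.ratio S j)).
  by field; exact: lt0r_neq0.
rewrite exprMn ler_wpM2r // exprn_ge0 // mulr_ge0 ?divr_ge0 // ltW //.
Qed.

(** * Decomposition of [mu] along the words of one generation *)

Definition word_weight (w : word m) : R := \prod_(j <- w) p j.

Lemma word_weight_rcons w j : word_weight (rcons w j) = word_weight w * p j.
Proof. by rewrite /word_weight -cats1 big_cat /= big_seq1. Qed.

Lemma word_weight_gt0 w : 0 < word_weight w.
Proof. by apply: prodr_gt0 => j _; exact: weight_gt0. Qed.

(** Self-similarity is applied to every word whose ratio still exceeds [lam ^+ n]. Each letter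
    multiplies the ratio by at most [q], so [k] bounds the number of letters still to be added; for
    [k = 0] the two bounds on the ratio contradict each other. *)
Lemma mass_Lambda_refine n (q : R) k w : 0 < q -> (forall j, Defs.ratio S j <= q) ->
  lam ^+ n < word_ratio S w -> word_ratio S w * q ^+ k <= lam ^+ n ->
  exists W : seq (word m), (forall u, u \in W -> Lambda S n u) /\
    forall E : set R, measurable (E : set (measurableTypeR R)) ->
      word_weight w * mass mu (word_map S w @^-1` E) =
      \sum_(u <- W) word_weight u * mass mu (word_map S u @^-1` E).
Proof.
move=> q0 ratio_q; elim: k w => [|k IH] w w_gt w_le.
  by move: w_gt w_le; rewrite expr0 mulr1; lra.
have children j : exists W : seq (word m), (forall u, u \in W -> Lambda S n u) /\
    forall E : set R, measurable (E : set (measurableTypeR R)) ->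
      word_weight (rcons w j) * mass mu (word_map S (rcons w j) @^-1` E) =
      \sum_(u <- W) word_weight u * mass mu (word_map S u @^-1` E).
  have [wj_le|wj_gt] := leP (word_ratio S (rcons w j)) (lam ^+ n).
    exists [:: rcons w j]; split=> [u|E mE]; last by rewrite big_seq1.
    rewrite inE => /eqP ->; split=> //.
    by rewrite /word_parent size_rcons /= -cats1 take_size_cat.
  apply: IH => //; apply: le_trans w_le.
  rewrite word_ratio_rcons exprS -mulrA ler_wpM2l ?(ltW (word_ratio_gt0 _ _)) //.
  by rewrite ler_pM2r ?exprn_gt0.
have [W_ HW_] := fin_all_exists children.
exists (flatten [seq W_ j | j <- index_enum 'I_m.+1]); split.
  by move=> u /flatten_mapP[j _ uj]; apply: (HW_ j).1.
move=> E mE; rewrite big_flatten big_map (mass_self_similar); last first.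
  exact: measurable_word_preimage.
rewrite mulr_sumr; apply: eq_bigr => j _; rewrite -(HW_ j).2 // word_weight_rcons.
rewrite mulrA; congr (_ * mass _ _).
by apply/seteqP; split=> x /=; rewrite word_map_rcons.
Qed.

(** Refine the empty word, whose ratio 1 exceeds [lam ^+ n] because [n] is positive. *)
Lemma mass_Lambda n : (0 < n)%N ->
  exists W : seq (word m), (forall u, u \in W -> Lambda S n u) /\
    forall E : set R, measurable (E : set (measurableTypeR R)) ->
      mass mu E = \sum_(u <- W) word_weight u * mass mu (word_map S u @^-1` E).
Proof.
move=> n0; have [q q01 ratio_q] := max_ratio_ex S.
have lam0 := min_ratio_gt0 S.
have [k qk] := expr_lt_ex q01 (exprn_gt0 n lam0).
have [|||W [WL HW]] := @mass_Lambda_refine n q k [::] _ ratio_q.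
- by case/andP: q01.
- by rewrite /word_ratio big_nil exprn_ilt1 ?ltW ?min_ratio_lt1 // -lt0n.
- by rewrite /word_ratio big_nil mul1r ltW.
exists W; split=> // E mE; rewrite -HW // /word_weight big_nil mul1r.
by congr (mass _ _).
Qed.

(** If [Q u] fails, the preimage of [E] under the map of [u] misses [[0, 1]] and is null; any other
    word contributes at most its weight. *)
Lemma mass_le_meeting_words (W : seq (word m)) (Q : pred (word m)) (E : set R) :
  measurable (E : set (measurableTypeR R)) ->
  mass mu E = \sum_(u <- W) word_weight u * mass mu (word_map S u @^-1` E) ->
  (forall u y, u \in W -> 0 <= y <= 1 -> E (word_map S u y) -> Q u) ->
  mass mu E <= \sum_(u <- W | Q u) word_weight u.
Proof.
move=> mE -> meetQ; rewrite [leRHS]big_mkcond /= big_seq [leRHS]big_seq.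
apply: ler_sum => u uW.
have mP : measurable (word_map S u @^-1` E : set (measurableTypeR R)).
  exact: measurable_word_preimage.
case: ifPn => [_|/negP nQ].
  by rewrite ler_piMr ?(ltW (word_weight_gt0 _)) // mass_le1.
by rewrite mass_off_unit ?mulr0 // => y Ey y01; apply: nQ; apply: meetQ Ey.
Qed.

Lemma mass_ge_words (W : seq (word m)) (Q : pred (word m)) (E : set R) (k : R) :
  mass mu E = \sum_(u <- W) word_weight u * mass mu (word_map S u @^-1` E) ->
  (forall u, u \in W -> Q u -> k <= mass mu (word_map S u @^-1` E)) ->
  k * (\sum_(u <- W | Q u) word_weight u) <= mass mu E.
Proof.
move=> -> Qk; rewrite mulr_sumr [leLHS]big_mkcond /= big_seq [leRHS]big_seq.
apply: ler_sum => u uW; have w0 := word_weight_gt0 u.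
case: ifPn => [/(Qk _ uW) ku|_]; last by rewrite mulr_ge0 ?mass_ge0 // ltW.
by rewrite mulrC ler_pM2l.
Qed.

(** [ball x r] contains the ball of radius [s] about [word_map S u z], whose preimage is a ball
    about [z] of radius at least [s / lam ^+ n]. *)
Lemma mass_word_preimage_ball_ge N n u (x z r s : R) :
  (forall j, Defs.ratio S j ^+ N <= p j) -> Lambda S n u ->
  0 <= z <= 1 -> 0 < s -> s <= lam ^+ n -> `|x - word_map S u z| + s <= r ->
  (lam * (s / lam ^+ n)) ^+ N <= mass mu (word_map S u @^-1` ball x r).
Proof.
move=> ratioN [u_le _] z01 s0 sn xzr.
have lam0 := min_ratio_gt0 S; have lamn0 := exprn_gt0 n lam0.
have u0 := word_ratio_gt0 S u.
apply: le_trans (mass_ball_ge ratioN z01 _ _) _; first by rewrite divr_gt0.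
  have sn1 : s / lam ^+ n <= 1 by rewrite ler_pdivrMr // mul1r.
  rewrite -[leRHS]mulr1; apply: ler_pM => //; rewrite ?divr_ge0 ?ltW //.
  exact: min_ratio_lt1.
apply: le_mass; first exact: measurable_ball.
  by apply: measurable_word_preimage; exact: measurable_ball.
apply: (@subset_trans _ (ball z (s / word_ratio S u))).
  by apply: le_ball; rewrite ler_pM2l // lef_pV2 ?posrE.
rewrite -word_preimage_ball; apply: preimage_subset => y; rewrite /ball /= => zy.
have := ler_distD (word_map S u z) x y; lra.
Qed.

(* Within distance [rho] of [x] the words of generation [n] have at most one left
   endpoint to the right of [x] and one right endpoint to its left. Shrinking the
   ball past each of them costs one factor [q]; then every word that meets it
   contains [x]. *)
Lemma mass_ball_descent N n (x r rho q : R) :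
  (forall j, Defs.ratio S j ^+ N <= p j) -> (0 < n)%N -> 0 <= x <= 1 ->
  0 < r <= lam ^+ n -> 0 < rho ->
  (forall u w z, Lambda S n u -> Lambda S n w -> z = 0 \/ z = 1 ->
    word_map S u z <> word_map S w z ->
    rho <= `|word_map S u z - word_map S w z|) ->
  0 <= q <= 1 ->
  (forall t, r / 2 < t -> t < rho ->
    q * mass mu (ball x (2 * t)) <= mass mu (ball x t)) ->
  ((lam * (r / 2 / lam ^+ n)) ^+ N) ^+ 3 * q ^+ 2 * mass mu (ball x rho)
    <= 4 * mass mu (ball x r).
Proof.
move=> ratioN n0 x01 /andP[r0 rn] rho0 gap q01 dbl.
have [W [WL HW]] := mass_Lambda n0.
have mB s : measurable (ball x s : set (measurableTypeR R)) by exact: measurable_ball.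
have lam0 := min_ratio_gt0 S; have lamn0 := exprn_gt0 n lam0.
set k := (_ ^+ N).
have k01 : 0 <= k <= 1.
  have h : r / 2 / lam ^+ n <= 1 by rewrite ler_pdivrMr // mul1r; lra.
  have h0 : 0 <= r / 2 / lam ^+ n by rewrite !divr_ge0 // ltW.
  have lh0 : 0 <= lam * (r / 2 / lam ^+ n) by rewrite mulr_ge0 // ltW.
  rewrite exprn_ge0 // exprn_ile1 // -[leRHS]mulr1.
  by apply: ler_pM => //; apply: ltW => //; exact: min_ratio_lt1.
(* [t] is the distance from [x] to the only left endpoint in the window to its right, or [rho] if
   there is none; [t'] is the mirror image for right endpoints. *)
have [t /andP[t0 trho] tE] : exists2 t, 0 < t <= rho &
    forall u, u \in W -> 0 < word_map S u 0 - x < rho -> word_map S u 0 - x = t.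
  apply: unique_value_ex => // u w /WL uL /WL wL neq.
  rewrite opprB addrA subrK; apply: gap => //; first by left.
  by move=> h; apply: neq; rewrite h.
have [t' /andP[t'0 t'rho] t'E] : exists2 t, 0 < t <= rho &
    forall u, u \in W -> 0 < x - word_map S u 1 < rho -> x - word_map S u 1 = t.
  apply: unique_value_ex => // u w /WL uL /WL wL neq.
  rewrite distrC (_ : _ - _ = word_map S u 1 - word_map S w 1); last ring.
  apply: gap => //; first by right.
  by move=> h; apply: neq; rewrite h.
pose cover u := word_map S u 0 <= x <= word_map S u 1.
pose above u := 0 < word_map S u 0 - x < rho.
pose below u := 0 < x - word_map S u 1 < rho.
pose wt (Q : pred (word m)) := \sum_(u <- W | Q u) word_weight u.
have ww0 u : 0 <= word_weight u by exact/ltW/word_weight_gt0.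
(* An interval that meets the ball without containing [x] lies on one side of [x], and its nearer
   endpoint is at distance exactly [t] or [t']. *)
have meet s u y : s <= rho -> u \in W -> 0 <= y <= 1 -> ball x s (word_map S u y) ->
    [\/ cover u, above u /\ t < s | below u /\ t' < s].
  move=> srho uW /andP[y0 y1]; rewrite /ball /= (word_mapE _ _ y) ltr_norml => /andP[lo hi].
  have u0 := word_ratio_gt0 S u; have S1 := word_mapE S u 1.
  have ry0 : 0 <= word_ratio S u * y by rewrite mulr_ge0 // ltW.
  have ry1 : 0 <= word_ratio S u * (1 - y) by rewrite mulr_ge0 ?subr_ge0 // ltW.
  have [S0x|xS0] := leP (word_map S u 0) x; last first.
    have au : above u by apply/andP; split; lra.
    by apply: Or32; split=> //; rewrite -(tE u uW au); lra.
  have [xS1|S1x] := leP x (word_map S u 1); first by apply: Or31; apply/andP.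
  have bu : below u by apply/andP; split; lra.
  by apply: Or33; split=> //; rewrite -(t'E u uW bu); lra.
(* The balls of radius [r / 2] about the points [word_map S u z] lie in [ball x s], so each of these
   words gives it a proportion at least [k] of its weight. *)
have near_word s (Q : pred (word m)) : r <= s ->
    (forall u, u \in W -> Q u ->
      exists2 z, 0 <= z <= 1 & `|x - word_map S u z| + r / 2 <= s) ->
    k * wt Q <= mass mu (ball x s).
  move=> rs Qs; apply: mass_ge_words (HW _ (mB s)) _ => u uW /(Qs u uW)[z z01 xz].
  by apply: mass_word_preimage_ball_ge ratioN (WL u uW) z01 _ _ xz; lra.
have covered : k * wt cover <= mass mu (ball x r).
  apply: near_word => // u uW /andP[S0x xS1]; have u0 := word_ratio_gt0 S u.
  have S1 := word_mapE S u 1.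
  exists ((x - word_map S u 0) / word_ratio S u).
    by apply/andP; split; [rewrite divr_ge0 ?subr_ge0 // ltW|rewrite ler_pdivrMr //; lra].
  by rewrite (word_mapE _ _ (_ / _)) mulrC divfK ?lt0r_neq0 // subrK subrr normr0; lra.
have side_mass (Q : pred (word m)) z d : 0 <= z <= 1 ->
    (forall u, u \in W -> Q u -> `|x - word_map S u z| = d /\ d < rho) ->
    k * wt Q <= mass mu (ball x r) \/ q * k * wt Q <= mass mu (ball x d).
  (* An actual word on this side is what yields [d < rho]; the default distance [rho] would not.
     Without such a word the weight is 0. *)
  move=> z01 Qd; have [/hasP[v vW Qv]|/hasPn none] := boolP (has Q W); last first.
    left; rewrite /wt big_seq_cond big1 ?mulr0 ?mass_ge0 //.
    by move=> u /andP[/none /negPf ->].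
  have [_ d_rho] := Qd v vW Qv.
  (* Either the endpoint is so close that [ball x r] contains its [r / 2]-ball, or [r / 2 < d],
     where the doubling hypothesis applies and carries the bound from radius [2 * d] to [d]. *)
  have [dr|rd] := leP (2 * d) r.
    left; apply: near_word => // u uW /(Qd u uW)[ud _].
    by exists z; rewrite // ud; lra.
  right; apply: le_trans (dbl d _ d_rho); last lra.
  rewrite -mulrA; apply: ler_wpM2l; first by case/andP: q01.
  apply: near_word => //; first exact: ltW.
  by move=> u uW /(Qd u uW)[ud _]; exists z; rewrite // ud; lra.
have above_mass : k * wt above <= mass mu (ball x r) \/
    q * k * wt above <= mass mu (ball x t).
  apply: (@side_mass _ 0) => [|u uW au]; first by rewrite lexx ler01.
  rewrite -(tE u uW au); case/andP: au => u_gt u_lt.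
  by rewrite distrC gtr0_norm.
have below_mass : k * wt below <= mass mu (ball x r) \/
    q * k * wt below <= mass mu (ball x t').
  apply: (@side_mass _ 1) => [|u uW bu]; first by rewrite lexx ler01.
  rewrite -(t'E u uW bu); case/andP: bu => u_gt u_lt.
  by rewrite gtr0_norm.
have upper s (Q : pred (word m)) : (forall u y, u \in W -> 0 <= y <= 1 ->
    ball x s (word_map S u y) -> Q u) -> mass mu (ball x s) <= wt Q.
  by move=> sQ; apply: mass_le_meeting_words (HW _ (mB s)) sQ.
have full : mass mu (ball x rho) <= wt cover + wt above + wt below.
  apply: (@le_trans _ _ (wt (fun u => (cover u || above u) || below u))).
    apply: upper => u y uW y01 /(meet _ _ _ (lexx _) uW y01).
    by move=> [->|[-> _]|[-> _]]; rewrite ?orbT.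
  apply: (le_trans (sum_orb_le _ _ _ ww0)).
  by rewrite lerD2r; exact: sum_orb_le.
have kq0 : 0 <= k ^+ 3 * q ^+ 2.
  by case/andP: k01 => ? _; case/andP: q01 => ? _; apply: mulr_ge0; apply: exprn_ge0.
apply: le_trans (ler_wpM2l kq0 full) _.
(* The nearer side is charged first: the open ball of the smaller radius meets only words that
   contain [x], and the one of the larger radius meets only these and the words of the nearer
   side. *)
have [tt'|t't] := leP t t'.
  apply: le_cascade => //; first exact: mass_ge0.
    case: above_mass => h; [by left|right]; apply: le_trans h (upper _ _ _).
    move=> u y uW y01 /(meet _ _ _ trho uW y01) [//|[_]|[_]]; first by rewrite ltxx.
    by rewrite ltNge tt'.
  case: below_mass => h; [by left|right]; apply: (le_trans h).
  apply: (@le_trans _ _ (wt (fun u => cover u || above u))).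
    apply: upper => u y uW y01 /(meet _ _ _ t'rho uW y01) [->//|[-> _]|[_]].
      by rewrite orbT.
    by rewrite ltxx.
  exact: sum_orb_le.
rewrite -addrA (addrC (wt above)) addrA.
apply: le_cascade => //; first exact: mass_ge0.
  case: below_mass => h; [by left|right]; apply: le_trans h (upper _ _ _).
  move=> u y uW y01 /(meet _ _ _ t'rho uW y01) [//|[_]|[_]]; last by rewrite ltxx.
  by rewrite ltNge ltW.
case: above_mass => h; [by left|right]; apply: (le_trans h).
apply: (@le_trans _ _ (wt (fun u => cover u || below u))).
  apply: upper => u y uW y01 /(meet _ _ _ trho uW y01) [->//|[_]|[-> _]].
    by rewrite ltxx.
  by rewrite orbT.
exact: sum_orb_le.
Qed.

End SelfSimilarMeasure.

(** * Quasi-Assouad exponents and quasi-doubling expressed by real masses *)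

Section QuasiAssouad.
Variables (R : realType) (mu : probability (measurableTypeR R) R).

Lemma mass_ball_gt0 (x r : R) : supp mu x -> 0 < r -> 0 < mass mu (ball x r).
Proof.
move=> sx r0; rewrite -lte_fin -massE; last exact: measurable_ball.
by apply: sx; [exact: ball_open|exact: ballxx].
Qed.

Lemma qA_exponentE (delta s : R) : qA_exponent mu delta s <->
  exists C1 C2 : R, [/\ 0 < C1, 0 < C2 &
    forall r rho : R, 0 < r -> r <= rho `^ (1 + delta) ->
      rho `^ (1 + delta) <= rho -> rho <= C1 ->
      forall x, supp mu x ->
        mass mu (ball x rho) <= C2 * (rho / r) `^ s * mass mu (ball x r)].
Proof.
have ratioE x r rho : supp mu x -> 0 < r ->
    (mu (ball x rho) / mu (ball x r))%E =
    (mass mu (ball x rho) / mass mu (ball x r))%:E.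
  move=> sx r0; rewrite !massE; try exact: measurable_ball.
  by rewrite inver gt_eqF ?mass_ball_gt0.
split=> -[C1 [C2 [C10 C20 H]]]; exists C1, C2; split=> // r rho r0 rrho rho1 rhoC.
  move=> x sx; rewrite -ler_pdivrMr ?mass_ball_gt0 //.
  rewrite -lee_fin -ratioE //; apply: le_trans (H r rho r0 rrho rho1 rhoC).
  by apply: ereal_sup_ubound; exists x.
apply: ge_ereal_sup => _ [x sx <-].
by rewrite ratioE // lee_fin ler_pdivrMr ?mass_ball_gt0 //; exact: H.
Qed.

Lemma qA_exponent_le (delta s s' : R) : s <= s' ->
  qA_exponent mu delta s -> qA_exponent mu delta s'.
Proof.
move=> ss' /qA_exponentE[C1 [C2 [C10 C20 H]]]; apply/qA_exponentE.
exists C1, C2; split=> // r rho r0 rrho rho1 rhoC x sx.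
apply: (le_trans (H r rho r0 rrho rho1 rhoC x sx)).
apply: ler_wpM2r; first exact: mass_ge0.
apply: ler_wpM2l; first exact: ltW.
by apply: ler_powR => //; rewrite ler_pdivlMr // mul1r; exact: le_trans rho1.
Qed.

Lemma qA_exponent_delta_le (delta delta' s : R) : delta <= delta' ->
  qA_exponent mu delta s -> 0 < delta -> qA_exponent mu delta' s.
Proof.
move=> dd' /qA_exponentE[C1 [C2 [C10 C20 H]]] d0; apply/qA_exponentE.
exists (Num.min C1 1), C2; split=> //; first by rewrite lt_min C10 ltr01.
move=> r rho r0 rrho rho1; rewrite le_min => /andP[rhoC rho_le1] x sx.
have rho0 : 0 < rho by lra.
apply: H => //.
  apply: (le_trans rrho); apply: ger_powR; last by rewrite lerD2l.
  by rewrite rho0.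
by rewrite ge1r_powR ?rho0 //; lra.
Qed.

Lemma qA_H_anti (delta delta' : R) : 0 < delta -> delta <= delta' ->
  (qA_H mu delta' <= qA_H mu delta)%E.
Proof.
move=> d0 dd'; apply: ereal_inf_le_tmp => _ [s Hs <-]; exists s => //.
exact: qA_exponent_delta_le Hs d0.
Qed.

(** By monotonicity the limit at [0] is the supremum of [qA_H] over []0, 1[], so its finiteness
    amounts to one exponent that serves all [delta]. *)
Lemma dim_qA_lty : (dim_qA mu < +oo)%E <->
  exists2 s : R, 0 <= s & forall delta, 0 < delta < 1 -> qA_exponent mu delta s.
Proof.
have cvH : qA_H mu delta @[delta --> 0^'+] --> ereal_sup
    [set qA_H mu delta | delta in [set` `]0, 1[]].
  apply: (nonincreasing_at_right_cvge (BLeft 1)); first by rewrite bnd_simp ltr01.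
  by move=> d d'; rewrite !in_itv /= => /andP[d0 _] _ dd'; exact: qA_H_anti.
have dimE : dim_qA mu = ereal_sup [set qA_H mu delta | delta in [set` `]0, 1[]].
  exact: cvg_lim cvH.
rewrite dimE; split=> [lty|[s s0 Hs]]; last first.
  apply: (@le_lt_trans _ _ s%:E); last exact: ltry.
  apply: ge_ereal_sup => _ [delta /= d01 <-]; apply: ereal_inf_lbound.
  by exists s => //; apply: Hs; move: d01; rewrite in_itv.
set h := ereal_sup _ in lty *.
have [s s0 hs] : exists2 s : R, 0 <= s & (h < s%:E)%E.
  case: h lty => [a| |] _ //.
    exists (`|a| + 1); first by rewrite addr_ge0.
    by rewrite lte_fin; have := ler_norm a; lra.
  by exists 0 => //; exact: ltNyr.
exists s => // delta d01.
have : (qA_H mu delta < s%:E)%E.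
  by apply: le_lt_trans hs; apply: ereal_sup_ubound; exists delta; rewrite //= in_itv.
move=> /ereal_inf_lt[_ [s' Hs' <-]]; rewrite lte_fin => /ltW s's.
exact: qA_exponent_le s's Hs'.
Qed.

Lemma quasi_doublingE : supp mu = `[0, 1]%classic -> quasi_doubling mu <->
  forall (eps : R) (G : R -> R), 0 < eps ->
    (forall r : R, 0 < r < 1 -> 0 < G r) ->
    (forall r s : R, 0 < r -> r <= s -> s < 1 -> G r <= G s) ->
    (ln (G r) / ln r) @[r --> 0^'+] --> (0 : R) ->
    exists2 c : R, 0 < c & forall x r : R, 0 <= x <= 1 -> 0 < r < 1 ->
      c * r `^ eps * mass mu (ball x (2 * r)) <= mass mu (ball x (G r * r)).
Proof.
move=> suppE; split=> qd eps G eps0 G0 ndG G1; have [c c0 H] := qd eps G eps0 G0 ndG G1;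
  exists c => // x r.
  move=> x01 r01; have := H x r; rewrite suppE !massE; try exact: measurable_ball.
  by rewrite -EFinM lee_fin; apply=> //=; rewrite in_itv.
rewrite suppE /= in_itv /= => x01 r01.
by rewrite !massE; [rewrite -EFinM lee_fin; exact: H|exact: measurable_ball..].
Qed.

Lemma cvg_at_right0P (f : R -> R) : f r @[r --> 0^'+] --> (0 : R) <->
  forall e, 0 < e -> exists2 d, 0 < d & forall r, 0 < r < d -> `|f r| < e.
Proof.
split=> [/cvgrPdist_lt H e e0|H].
  have [d /= d0 Hd] := H _ e0; exists d => // r /andP[r0 rd].
  by rewrite -normrN -sub0r; apply: Hd => //=; rewrite sub0r normrN gtr0_norm.
apply/cvgrPdist_lt => e e0; have [d d0 Hd] := H _ e0.
near=> r; rewrite sub0r normrN; apply: Hd; apply/andP; split; near: r.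
  exact: nbhs_right_gt.
exact: nbhs_right_lt.
Unshelve. all: by end_near. Qed.

End QuasiAssouad.

(** * The two implications between finite dimension and quasi-doubling *)

Section Equivalence.
Variables (R : realType) (m : nat) (S : ifs R m) (p : 'I_m.+1 -> R).
Variable mu : probability (measurableTypeR R) R.
Hypothesis hF : is_attractor S `[0, 1]%classic.
Hypothesis hmu : self_similar S p mu.
Hypothesis hsupp : supp mu = `[0, 1]%classic.

Local Notation lam := (min_ratio S).

(** This uniform bound settles quasi-doubling for radii bounded away from 0. *)
Lemma mass_ball_unit_gt0 (rho : R) : 0 < rho ->
  exists2 c : R, 0 < c & forall x : R, 0 <= x <= 1 -> c <= mass mu (ball x rho).
Proof.
move=> rho0; have [N ratioN] := weight_exponent_ex hmu.
have lam0 := min_ratio_gt0 S; have lam1 := min_ratio_lt1 S.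
have m0 : 0 < Num.min rho 1 by rewrite lt_min rho0 ltr01.
exists ((lam * Num.min rho 1) ^+ N); first by rewrite exprn_gt0 // mulr_gt0.
move=> x x01; apply: (@le_trans _ _ (mass mu (ball x (Num.min rho 1)))).
  apply: (mass_ball_ge hF hmu) => //.
  rewrite -[leRHS]mulr1; apply: ler_pM; rewrite ?(ltW lam0) ?(ltW lam1) ?(ltW m0) //.
  by rewrite ge_min lexx orbT.
by apply: le_mass_ball; rewrite ge_min lexx.
Qed.

Lemma qA_exponent_quasi_doubling (s : R) : 0 <= s ->
  (forall delta, 0 < delta < 1 -> qA_exponent mu delta s) -> quasi_doubling mu.
Proof.
move=> s0 Hs; apply/(quasi_doublingE hsupp) => eps G eps0 G0 ndG /cvg_at_right0P G1.
(* This gives [delta * s <= eps]; the denominator [s + 1] avoids division by zero. *)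
pose delta := Num.min (1 / 2) (eps / (s + 1)).
have delta0 : 0 < delta by rewrite lt_min !divr_gt0 //; lra.
have delta1 : delta < 1 by rewrite gt_min; apply/orP; left; lra.
have deltas : delta * s <= eps.
  have : delta * (s + 1) <= eps.
    by rewrite -ler_pdivlMr ?ge_min ?lexx ?orbT //; lra.
  by rewrite mulrDr mulr1; lra.
have /qA_exponentE[C1 [C2 [C10 C20 H]]] := Hs delta ltac:(by rewrite delta0).
have [d d0 Hd] := G1 _ delta0.
(* For [r < r0] the bound on [ln (G r) / ln r] holds, and [2 * r] is at most both [C1] and 1, as an
   outer radius must be. *)
pose r0 := Num.min (d / 2) (Num.min (C1 / 2) (1 / 2)).
have r00 : 0 < r0 by rewrite !lt_min !divr_gt0.
have r0d : r0 <= d / 2 by rewrite ge_min lexx.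
have r0C : r0 <= C1 / 2 by rewrite !ge_min lexx orbT.
have r01 : r0 <= 1 / 2 by rewrite !ge_min lexx !orbT.
have Gr0 : 0 < G r0 * r0 by rewrite mulr_gt0 // G0 // r00; lra.
have [k k0 Hk] := mass_ball_unit_gt0 Gr0.
have M0 : 0 < C2 * 2 `^ s by rewrite mulr_gt0 // powR_gt0.
exists (Num.min k (C2 * 2 `^ s)^-1); first by rewrite lt_min k0 invr_gt0.
move=> x r x01 /andP[rgt0 rlt1].
have reps0 : 0 < r `^ eps by rewrite powR_gt0.
(* For [r0 <= r] monotonicity of [G] gives [G r0 * r0 <= G r * r], so the right-hand side is at
   least [k]. *)
have [r0r|rr0] := leP r0 r.
  apply: (@le_trans _ _ k); last first.
    apply: (le_trans (Hk x x01)); apply: le_mass_ball.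
    by apply: ler_pM => //; [rewrite ltW // G0 // r00; lra|exact: ltW|exact: ndG].
  have reps1 : r `^ eps <= 1 by rewrite -(powRr0 r) ger_powR ?rgt0 ?ltW.
  have mB1 : mass mu (ball x (2 * r)) <= 1 by apply: mass_le1; exact: measurable_ball.
  have mk : Num.min k (C2 * 2 `^ s)^-1 <= k by rewrite ge_min lexx.
  have mk0 : 0 < Num.min k (C2 * 2 `^ s)^-1 by rewrite lt_min k0 invr_gt0.
  rewrite -[leRHS]mulr1; apply: ler_pM => //; last 1 first.
  - rewrite -[leRHS]mulr1; apply: ler_pM => //; exact: ltW.
  - by rewrite mulr_ge0 // ltW.
  - exact: mass_ge0.
have Grdelta : r `^ delta <= G r.
  have lnr : ln r < 0 by apply: ln_lt0; rewrite rgt0.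
  have Gr : 0 < G r by rewrite G0 // rgt0.
  rewrite -ler_ln ?posrE ?powR_gt0 // ln_powR.
  have : ln (G r) / ln r < delta.
    by apply: le_lt_trans (ler_norm _) (Hd r _); rewrite rgt0; lra.
  by rewrite ltr_ndivrMr // => /ltW.
have powr : r `^ (1 + delta) = r * r `^ delta.
  by rewrite powRD ?powRr1 ?(ltW rgt0) // (gt_eqF rgt0) implybT.
have r1d0 : 0 < r `^ (1 + delta) by rewrite powR_gt0.
have step : mass mu (ball x (2 * r)) <=
    C2 * (2 * r / r `^ (1 + delta)) `^ s * mass mu (ball x (r `^ (1 + delta))).
  apply: H => //.
  - by apply: ge0_ler_powR; rewrite ?nnegrE; lra.
  - by apply: ge1r_powR; [apply/andP; split; lra|lra].
  - by lra.
  - by rewrite hsupp /= in_itv.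
have step' : mass mu (ball x (2 * r)) <=
    C2 * (2 `^ s * r `^ (- (delta * s))) * mass mu (ball x (G r * r)).
  apply: (le_trans step).
  have -> : 2 * r / r `^ (1 + delta) = 2 * r `^ (- delta).
    rewrite powr powRN; field.
    by rewrite !gt_eqF // powR_gt0.
  rewrite powRM ?powR_ge0 // -powRrM mulNr; apply: ler_wpM2l.
    by rewrite !mulr_ge0 ?powR_ge0 // ltW.
  by apply: le_mass_ball; rewrite powr mulrC ler_pM2r.
have mB0 := mass_ge0 mu (ball x (G r * r)).
set a := mass mu (ball x (2 * r)) in step' *.
set b := mass mu (ball x (G r * r)) in mB0 step' *.
have ra : r `^ eps * a <= C2 * 2 `^ s * b.
  apply: (@le_trans _ _ (r `^ eps * (C2 * (2 `^ s * r `^ (- (delta * s))) * b))).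
    by rewrite ler_pM2l.
  rewrite (_ : r `^ eps * _ = C2 * 2 `^ s * b * (r `^ eps * r `^ (- (delta * s)))); last ring.
  rewrite ler_piMr //; first by rewrite mulr_ge0 // ltW.
  rewrite -powRD; last by rewrite (gt_eqF rgt0) implybT.
  by rewrite -(powRr0 r) ger_powR ?rgt0 ?(ltW rlt1) //; lra.
rewrite -mulrA; apply: (@le_trans _ _ ((C2 * 2 `^ s)^-1 * (r `^ eps * a))).
  apply: ler_wpM2r; first by rewrite mulr_ge0 ?mass_ge0 // ltW.
  by rewrite ge_min lexx orbT.
by rewrite ler_pdivrMl.
Qed.

(** For [0 < rho < 1] this is the largest [n] with [rho <= lam ^+ n], the generation whose scale is
    comparable to [rho]. *)
Definition depth (rho : R) : nat := Num.trunc (ln rho / ln lam).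

Lemma ln_min_ratio_lt0 : ln lam < 0.
Proof. by apply: ln_lt0; rewrite min_ratio_gt0 min_ratio_lt1. Qed.

Lemma leq_depth n (rho : R) : 0 < rho < 1 -> (n <= depth rho)%N = (rho <= lam ^+ n).
Proof.
move=> /andP[rho0 rho1]; have l0 := ln_min_ratio_lt0; have lam0 := min_ratio_gt0 S.
have lr0 : ln rho < 0 by apply: ln_lt0; rewrite rho0.
rewrite truncn_ge_nat; last by rewrite -mulrNN mulr_ge0 // -?invrN ?invr_ge0; lra.
by rewrite ler_ndivlMr // -[RHS]ler_ln ?posrE ?exprn_gt0 // lnXn // mulr_natl.
Qed.

Lemma le_depth (r s : R) : 0 < r -> r <= s -> s < 1 -> (depth s <= depth r)%N.
Proof.
move=> r0 rs s1; rewrite leq_depth; last by rewrite r0 (le_lt_trans rs).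
by apply: (le_trans rs); rewrite -leq_depth // s1 (lt_le_trans r0).
Qed.

Lemma ln_min1_le (y : R) : 0 < y -> `|ln (Num.min 1 y)| <= `|ln y|.
Proof. by move=> y0; case: (leP 1 y) => // _; rewrite ln1 normr0. Qed.

(** With [n = depth r], the bound [r <= lam ^+ n] makes [n] at most a constant times [- ln r], so
    [ln (f n) = o(n)] is [o(ln r)]. The cap at 1 can only shrink the absolute value of the
    logarithm. *)
Lemma depth_subpolynomial (f : nat -> R) : (forall n, 0 < f n) ->
  (ln (f n) / n%:R) @[n --> \oo] --> (0 : R) ->
  (ln (Num.min 1 (f (depth r))) / ln r) @[r --> 0^'+] --> (0 : R).
Proof.
move=> f0 /cvgrPdist_lt f_cvg; apply/cvg_at_right0P => e e0.
have l0 := ln_min_ratio_lt0; have lam0 := min_ratio_gt0 S; have lam1 := min_ratio_lt1 S.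
have el0 : 0 < e * - ln lam by rewrite mulr_gt0 //; lra.
have [n0 _ Hn0] := f_cvg _ el0.
exists (lam ^+ n0.+1) => [|r /andP[r0 rd]]; first exact: exprn_gt0.
have r1 : r < 1 by apply: (lt_le_trans rd); rewrite exprn_ile1 // ltW.
have r01 : 0 < r < 1 by rewrite r0.
have lr0 : ln r < 0 by exact: ln_lt0.
have n0d : (n0 < depth r)%N by rewrite leq_depth // ltW.
have := Hn0 _ (ltnW n0d); rewrite /= sub0r normrN.
have : r <= lam ^+ depth r by rewrite -leq_depth.
set n := depth r in n0d *.
have n_gt0 : 0 < n%:R :> R by rewrite ltr0n (leq_ltn_trans _ n0d).
rewrite -ler_ln ?posrE ?exprn_gt0 // lnXn // -[leRHS]mulr_natl => lr.
rewrite 2!normf_div (gtr0_norm n_gt0) (ltr0_norm lr0) ltr_pdivrMr // => lfn.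
rewrite ltr_pdivrMr; last by lra.
apply: (le_lt_trans (ln_min1_le (f0 n))); apply: (lt_le_trans lfn).
by rewrite -mulrA ler_pM2l //; lra.
Qed.

Lemma quasi_doubling_qA_exponent : AGWSC S -> quasi_doubling mu ->
  exists2 s : R, 0 <= s & forall delta, 0 < delta < 1 -> qA_exponent mu delta s.
Proof.
move=> [f [f0 f_anti f_cvg gap]] /(quasi_doublingE hsupp) qd.
have [N ratioN] := weight_exponent_ex hmu.
have lam0 := min_ratio_gt0 S; have lam1 := min_ratio_lt1 S.
exists ((3 * N).+1%:R) => // delta /andP[delta0 delta1]; apply/qA_exponentE.
pose eps := delta / (3 * (1 + delta)).
have eps0 : 0 < eps by rewrite divr_gt0 //; lra.
(* The cap keeps [G rho * rho] below [rho], so the radii [t] in the descent stay below 1. *)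
pose G r := Num.min 1 (f (depth r)).
have G0 r : 0 < G r by rewrite lt_min ltr01 f0.
have [c1 c10 qd1] : exists2 c : R, 0 < c & forall x r : R, 0 <= x <= 1 -> 0 < r < 1 ->
    c * r `^ eps * mass mu (ball x (2 * r)) <= mass mu (ball x (G r * r)).
  apply: qd => // [r s r0 rs s1|]; last exact: depth_subpolynomial.
  by rewrite le_min !ge_min lexx /= f_anti ?orbT // le_depth.
have [c2 c20 qd2] : exists2 c : R, 0 < c & forall x r : R, 0 <= x <= 1 -> 0 < r < 1 ->
    c * r `^ eps * mass mu (ball x (2 * r)) <= mass mu (ball x (1 * r)).
  apply: (qd eps (fun=> 1)) => //.
  by rewrite ln1; under eq_fun do rewrite mul0r; exact: cvg_cst.
pose c := Num.min c2 1.
have c0 : 0 < c by rewrite lt_min c20 ltr01.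
have c_le1 : c <= 1 by rewrite ge_min lexx orbT.
have c_le2 : c <= c2 by rewrite ge_min lexx.
pose h : R := 2^-1 `^ eps.
have h0 : 0 < h by rewrite powR_gt0.
(* The factor [lam / 2] arises from [lam <= rho / lam ^+ n], and [h] from evaluating the power at
   [r / 2]. *)
pose K := ((lam * (lam / 2)) ^+ N) ^+ 3 * (c * h) ^+ 2 * c1.
have K0 : 0 < K by rewrite !(mulr_gt0, exprn_gt0, divr_gt0).
(* Taking [C1 = lam] ensures that the generation [depth rho] is at least 1. *)
exists lam, (4 / K); split=> // [|r rho r0 r_le rho_le rho_lam x]; first by rewrite divr_gt0.
rewrite hsupp /= in_itv /= => x01.
have rho0 : 0 < rho by lra.
have rho1 : 0 < rho < 1 by rewrite rho0; lra.
have r_rho : r <= rho by exact: le_trans rho_le.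
have [n nE] : exists n, n = depth rho by exists (depth rho).
have n_gt0 : (0 < n)%N by rewrite nE leq_depth // expr1.
have rho_n : rho <= lam ^+ n by rewrite -leq_depth // nE.
have n_rho : lam ^+ n.+1 < rho by rewrite ltNge -leq_depth // nE ltnn.
have lamn0 : 0 < lam ^+ n by rewrite exprn_gt0.
pose A := r `^ eps.
have A0 : 0 < A by rewrite powR_gt0.
have qE : (r / 2) `^ eps = h * A by rewrite powRM ?invr_ge0 ?ltW // mulrC.
have q01 : 0 <= c * (h * A) <= 1.
  apply/andP; split; first by rewrite !mulr_ge0 ?ltW.
  rewrite -qE -[leRHS]mulr1; apply: ler_pM => //; [exact: ltW|exact: powR_ge0|].
  by rewrite -[leRHS](powRr0 (r / 2)); apply: ger_powR; [apply/andP; split; lra|exact: ltW].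
have G1 : G rho <= 1 by rewrite ge_min lexx.
have Grho : G rho * rho <= rho by rewrite ler_piMl // ltW.
have descent : ((lam * (r / 2 / lam ^+ n)) ^+ N) ^+ 3 * (c * (h * A)) ^+ 2 *
    mass mu (ball x (G rho * rho)) <= 4 * mass mu (ball x r).
  apply: (mass_ball_descent hF hmu) => //.
  - by rewrite r0; exact: le_trans rho_n.
  - by rewrite mulr_gt0.
  - move=> u w z uL wL z01 neq; apply: le_trans (gap n u w z n_gt0 uL wL z01 neq).
    apply: ler_pM => //; [exact: ltW|exact: ltW|].
    by rewrite /G -nE ge_min lexx orbT.
  - move=> t rt trho.
    have t0 : 0 < t by lra.
    have := qd2 x t x01 ltac:(by rewrite t0; lra); rewrite mul1r; apply: le_trans.
    apply: ler_wpM2r; first exact: mass_ge0.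
    apply: ler_pM => //; [exact: ltW|by rewrite mulr_ge0 ?ltW|].
    by rewrite -qE; apply: ge0_ler_powR; rewrite ?nnegrE; lra.
have first_step : c1 * A * mass mu (ball x rho) <= mass mu (ball x (G rho * rho)).
  apply: le_trans (qd1 x rho x01 rho1); apply: ler_pM; first by rewrite mulr_ge0 ?ltW.
  - exact: mass_ge0.
  - by rewrite ler_pM2l //; apply: ge0_ler_powR; rewrite ?nnegrE; lra.
  - by apply: le_mass_ball; lra.
have A3 : r / rho <= A ^+ 3.
  have -> : A ^+ 3 = r `^ (delta / (1 + delta)).
    rewrite -powR_mulrn ?ltW // -powRrM; congr (_ `^ _).
    by rewrite /eps; field; lra.
  have : r `^ (1 + delta)^-1 <= rho.
    have d1 : 1 + delta != 0 by rewrite gt_eqF //; lra.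
    rewrite (_ : rho = (rho `^ (1 + delta)) `^ (1 + delta)^-1); last first.
      by rewrite -powRrM mulfV // powRr1 // ltW.
    by apply: ge0_ler_powR; rewrite ?nnegrE ?invr_ge0 ?powR_ge0 //; lra.
  rewrite ler_pdivrMr // => h1.
  apply: (@le_trans _ _ (r `^ (delta / (1 + delta)) * r `^ (1 + delta)^-1)).
    rewrite -powRD; last by rewrite (gt_eqF r0) implybT.
    rewrite (_ : delta / (1 + delta) + (1 + delta)^-1 = 1) ?powRr1 ?(ltW r0) //.
    by field; lra.
  by rewrite ler_wpM2l // powR_ge0.
pose y := r / rho.
have y0 : 0 < y by rewrite divr_gt0.
have a0 : 0 < lam * (lam / 2) by rewrite !(mulr_gt0, divr_gt0).
have kE : ((lam * (lam / 2)) ^+ N) ^+ 3 * y ^+ (3 * N) <=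
    ((lam * (r / 2 / lam ^+ n)) ^+ N) ^+ 3.
  have b0 : 0 < lam * (r / 2 / lam ^+ n) by rewrite !(mulr_gt0, invr_gt0).
  rewrite (mulnC 3%N) exprM -!exprMn lerXn2r ?nnegrE ?exprn_ge0 ?(ltW b0) //.
    by rewrite mulr_ge0 ?ltW.
  rewrite lerXn2r ?nnegrE ?(ltW b0) //; first by rewrite mulr_ge0 ?ltW.
  have lam_le : lam <= rho / lam ^+ n by rewrite ler_pdivlMr // -exprS ltW.
  rewrite (_ : r / 2 / lam ^+ n = rho / lam ^+ n / 2 * y); last first.
    by rewrite /y; field; rewrite !gt_eqF.
  by rewrite -[leLHS]mulrA ler_pM2l // ler_pM2r // ler_pM2r.
have Ky : K * y ^+ (3 * N).+1 * mass mu (ball x rho) <= 4 * mass mu (ball x r).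
  apply: le_trans descent.
  set k3 := (lam * (r / 2 / lam ^+ n)) ^+ N ^+ 3 in kE *.
  have k30 : 0 <= k3 by rewrite !exprn_ge0 // ltW // !(mulr_gt0, invr_gt0).
  apply: (@le_trans _ _ (k3 * (c * (h * A)) ^+ 2 * (c1 * A * mass mu (ball x rho)))).
    rewrite (_ : K * y ^+ (3 * N).+1 * mass mu (ball x rho) =
      (((lam * (lam / 2)) ^+ N) ^+ 3 * y ^+ (3 * N) * y) *
      ((c * h) ^+ 2 * c1 * mass mu (ball x rho))); last by rewrite /K (exprSr y); ring.
    rewrite (_ : k3 * _ * _ = (k3 * A ^+ 3) * ((c * h) ^+ 2 * c1 * mass mu (ball x rho)));
      last ring.
    apply: ler_wpM2r.
      by rewrite !mulr_ge0 ?exprn_ge0 ?mass_ge0 ?ltW // mulr_gt0.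
    apply: (ler_pM _ (ltW y0) kE A3).
    by apply: mulr_ge0; do ?apply: exprn_ge0; exact: ltW.
  by apply: ler_wpM2l => //; rewrite mulr_ge0 // exprn_ge0 //; case/andP: q01.
rewrite powR_mulrn; last by rewrite divr_ge0 ?ltW.
rewrite (_ : 4 / K * _ * _ = 4 * mass mu (ball x r) / (K * y ^+ (3 * N).+1)).
  by rewrite ler_pdivlMr ?mulr_gt0 ?exprn_gt0 // mulrC.
rewrite (_ : rho / r = y^-1); last by rewrite /y invf_div.
rewrite exprVn; have := exprn_gt0 (3 * N).+1 y0; set z := y ^+ _ => z0.
by field; rewrite !gt_eqF.
Qed.

End Equivalence.

Theorem corollary4p5 (R : realType) (m : nat) (S : ifs R m) (p : 'I_m.+1 -> R)
    (mu : probability (measurableTypeR R) R)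
    (hF : is_attractor S `[0, 1]%classic)
    (hS0 : ifs_map S ord0 0 = 0)
    (hS1 : ifs_map S ord_max 1 = 1)
    (hmu : self_similar S p mu)
    (hS : AGWSC S)
    (hsupp : supp mu = `[0, 1]%classic) :
  (dim_qA mu < +oo)%E <-> quasi_doubling mu.
Proof.
split=> [/dim_qA_lty[s s0 Hs]|qd].
  exact: qA_exponent_quasi_doubling hF hmu hsupp s s0 Hs.
apply/dim_qA_lty; exact: quasi_doubling_qA_exponent hF hmu hsupp hS qd.
Qed.
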